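(* Let $K,n$ be positive integers and let $G$ be a group having a $K$-approximate subgroup $A$ such that $|[g,a]^G|\leq n$ for all $g\in G$ and $a\in A$. Then the commutator subgroup of $[G,A]$ has finite $(K,n)$-bounded order; that is, there is a function $f$ of two positive integer variables (independent of $G$ and $A$) such that for all such $K,n,G,A$ the commutator subgroup of $[G,A]$ is finite of order at most $f(K,n)$.
   Context: A subset $A$ of a group $G$ is symmetric if $A=A^{-1}$. For a positive integer $K$, a symmetric subset $A$ of a group $G$ is a $K$-approximate subgroup if there is a finite subset $E\subseteq G$ such that $|E|\leq K$ and $AA\subseteq EA$, where $AA=\{ab: a,b\in A\}$ and $EA=\{ea: e\in E, a\in A\}$. The group $G$ and the set $A$ may be infinite. For $x\in G$, $x^G$ denotes the conjugacy class of $x$ in $G$. Conventions: $x^g=g^{-1}xg$ and $[x,y]=x^{-1}y^{-1}xy$. For a subset $A\subseteq G$, $[G,A]$ denotes the subgroup generated by all commutators $[g,a]$ with $g\in G$ and $a\in A$ (it is a normal subgroup of $G$). *)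

(* Defs.v *)
From mathcomp Require Import all_boot all_fingroup.
From mathcomp Require Import all_classical.

Set Implicit Arguments.
Unset Strict Implicit.
Unset Printing Implicit Defensive.

Local Open Scope classical_set_scope.
Local Open Scope card_scope.
Local Open Scope group_scope.

(* [groupType] covers infinite groups; subsets are classical sets.  The library
   conventions are [x ^ g = g^-1 * (x * g)] and [[~ x, y] = x^-1 * x ^ y].  For
   a set [S], [S #<= `I_m] says that [S] injects into {0, ..., m - 1}, i.e. that
   [S] is finite with at most [m] elements. *)

Section Defs.
Variable G : groupType.
Implicit Types (A B H S : set G) (x : G) (K : nat).

Definition set_inv A : set G := [set a^-1 | a in A].

Definition set_mul A B : set G := [set a * b | a in A & b in B].

Definition symmetric_set A := A = set_inv A.

(* The empty set is allowed. *)
Definition approx_subgroup K A :=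
  symmetric_set A /\
  exists E : set G,
    [/\ finite_set E, E #<= `I_K & set_mul A A `<=` set_mul E A].

Definition conj_class x : set G := [set x ^ g | g in [set: G]].

Definition is_subgroup H :=
  [/\ H 1, forall x y, H x -> H y -> H (x * y) & forall x, H x -> H x^-1].

Definition gen_subgroup S : set G := smallest is_subgroup S.

Definition comm_subgroup A B : set G :=
  gen_subgroup [set [~ a, b] | a in A & b in B].

End Defs.

(* Main.v *)
(* Write H = [G, A] and call y good if [y, H] lies in a normal subgroup N of G of
   bounded order, i.e. if y centralizes H modulo N.  Good elements multiply, and
   an element of H with a bounded class is good by Schur's theorem.

   Given a family of good elements, choose a with the largest H-class, and write
   that class as the a ^ b_i with each b_i a short word in elements of H with at
   most n conjugates, so that some normal subgroup V of bounded index
   centralizes every b_i.  By maximality, if v is in V and v a is in the family,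
   then the class of v a is made of the v a ^ b_i, and v centralizes H modulo the
   same N as a.  For a = [d, e] and the commutators [u d, e v] this bounds [u, e],
   [d, v] and [u, v] modulo N.

   This is used twice.  First, AA is contained in EA with E finite and E
   contained in AAA, which makes [G, <E>] centralize H modulo a bounded N.  As
   <A> \ {1} is contained in <E>A, all [g, b] with b in <A> are uniformly good.
   Second, as <A> is a subgroup, choosing a maximal commutator in every pair of
   cosets of a V shows that [V', <A>] and [G, V' \cap <A>] centralize H modulo a
   bounded N, for a smaller V' of bounded index; the finitely many commutators
   of coset representatives of V' are good too.  So H centralizes H modulo a
   bounded normal subgroup, which therefore contains H'. *)
Require Import Defs.
From mathcomp Require Import all_boot all_fingroup.
From mathcomp Require Import all_classical.
From mathcomp Require Import zify.

Local Open Scope classical_set_scope.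
Local Open Scope card_scope.
Local Open Scope group_scope.

Set Implicit Arguments.
Unset Strict Implicit.
Unset Printing Implicit Defensive.

(** * Sets covered by lists of bounded length *)

Definition covered (T : eqType) (P : T -> Prop) (m : nat) :=
  exists2 s : seq T, (size s <= m)%N & forall x, P x -> x \in s.

Lemma covered_le (T : eqType) (P : T -> Prop) m m' :
  (m <= m')%N -> covered P m -> covered P m'.
Proof. by move=> le_mm' [s /leq_trans sm sP]; exists s => //; apply: sm. Qed.

Lemma covered_sub (T : eqType) (P Q : T -> Prop) m :
  (forall x, P x -> Q x) -> covered Q m -> covered P m.
Proof. by move=> PQ [s sm sQ]; exists s => // x /PQ/sQ. Qed.

Lemma covered_image (T U : eqType) (f : T -> U) (P : T -> Prop) m :
  covered P m -> covered (fun y => exists2 x, P x & y = f x) m.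
Proof.
move=> [s sm sP]; exists (map f s); first by rewrite size_map.
by move=> y [x Px ->]; rewrite map_f ?sP.
Qed.

Lemma covered_image2 (T U V : eqType) (f : T -> U -> V)
    (P : T -> Prop) (Q : U -> Prop) m m' :
  covered P m -> covered Q m' ->
  covered (fun z => exists2 x, P x & exists2 y, Q y & z = f x y) (m * m')%N.
Proof.
move=> [s sm sP] [t tm tQ]; exists [seq f x y | x <- s, y <- t].
  by rewrite size_allpairs leq_mul.
by move=> z [x Px [y Qy ->]]; apply: allpairs_f; [apply: sP|apply: tQ].
Qed.

Lemma covered_card_le (T : choiceType) (P : set T) m :
  P #<= `I_m -> covered P m.
Proof.
move=> Pm; have Pfin : finite_set P by apply/finite_set_leP; exists m.
exists (finmap.enum_fset (fset_set P)); first exact: geq_card_fset_set.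
by move=> x Px; rewrite in_fset_set // inE.
Qed.

Lemma card_le_covered (T : choiceType) (P : set T) m :
  covered P m -> finite_set P /\ P #<= `I_m.
Proof.
move=> [s sm sP]; split.
  by apply: (sub_finite_set _ (finite_seq s)) => x /sP.
have idx : set_fun P `I_m (fun x => index x s).
  by move=> x /sP xs /=; apply: leq_trans sm; rewrite index_mem.
have inj : {in P &, injective (fun x => index x s)}.
  move=> x y; rewrite !inE => /sP xs /sP ys exy.
  by rewrite -(nth_index x xs) exy nth_index.
rewrite -(card_le_eql (inj_card_eq inj)).
apply: subset_card_le => _ [x Px <-]; exact: idx.
Qed.

Lemma leq_exp2rW m n e : (m <= n)%N -> (m ^ e <= n ^ e)%N.
Proof. by case: e => // e; rewrite leq_exp2r. Qed.

Fixpoint words (T : eqType) (s : seq T) k : seq (seq T) :=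
  if k is k'.+1 then [seq x :: w | x <- s, w <- words s k'] else [:: [::]].

Lemma size_words (T : eqType) (s : seq T) k : size (words s k) = (size s ^ k)%N.
Proof. by elim: k => //= k IHk; rewrite size_allpairs IHk expnS. Qed.

Lemma mem_words (T : eqType) (s w : seq T) :
  {subset w <= s} -> w \in words s (size w).
Proof.
elim: w => //= x w IHw sub; apply: allpairs_f; first by rewrite sub ?mem_head.
by apply: IHw => y yw; apply: sub; rewrite inE yw orbT.
Qed.

(** Keeping one point of [P] for each value attained on [P] yields, later on, coset representatives
    inside a prescribed set. *)
Lemma covered_reps (T U : eqType) (c : T -> U) (s : seq U) (P : T -> Prop) :
  (forall x, P x -> c x \in s) ->
  exists r : seq T, [/\ (size r <= size s)%N, forall x, x \in r -> P x &
    forall x, P x -> exists2 y, y \in r & c x = c y].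
Proof.
move=> cs; suff [r [rs rP rc]] : exists r : seq T,
    [/\ (size r <= size s)%N, forall x, x \in r -> P x &
      forall x, P x -> c x \in s -> exists2 y, y \in r & c x = c y].
  by exists r; split=> // x Px; apply: rc => //; apply: cs.
elim: s {cs} => [|u s [r [rs rP rc]]]; first by exists [::].
have [[z [Pz cz]]|nex] := pselect (exists z, P z /\ c z = u).
  exists (z :: r); split=> //= [x|x Px].
    by rewrite inE => /predU1P[->|/rP].
  rewrite inE => /predU1P[->|/(rc _ Px)[y yr ->]].
    by exists z; rewrite ?mem_head.
  by exists y; rewrite // inE yr orbT.
exists r; split=> //= [|x Px]; first exact: leqW.
rewrite inE => /predU1P[cx|]; last exact: rc.
by case: nex; exists x.
Qed.

Lemma count_large (T : eqType) (s w : seq T) k :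
  {subset w <= s} -> (size s * k < size w)%N ->
  exists2 c, c \in s & (k < count_mem c w)%N.
Proof.
move=> sub lt_w; apply: contrapT => small; move: lt_w; apply/negP; rewrite -leqNgt.
have {}small c : c \in s -> (count_mem c w <= k)%N.
  by move=> cs; rewrite leqNgt; apply/negP => ?; apply: small; exists c.
elim: s w sub small => [|u s IHs] w sub small.
  by case: w sub {small} => // x w /(_ x (mem_head _ _)).
rewrite mulSn -(count_predC (pred1 u) w) leq_add ?small ?mem_head //.
rewrite -size_filter; apply: IHs => [x|c cs].
  by rewrite mem_filter /= => /andP[xu /sub]; rewrite inE (negPf xu).
rewrite -size_filter -filter_predI size_filter.
apply: leq_trans (small c _); last by rewrite inE cs orbT.
by apply: sub_count => x /= /andP[].
Qed.

(** * Commutator identities and generated subgroups *)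

Section Groups.
Variable G : groupType.
Implicit Types (x y z t g h : G) (S T N : set G) (w : seq G).

Lemma commMg x y z : [~ x * y, z] = [~ x, z] ^ y * [~ y, z].
Proof. by rewrite /commg /conjg ?gnorm. Qed.

Lemma commgM x y z : [~ z, x * y] = [~ z, y] * [~ z, x] ^ y.
Proof. by rewrite /commg /conjg ?gnorm. Qed.

Lemma commVg x y : [~ x^-1, y] = ([~ x, y]^-1) ^ x^-1.
Proof. by rewrite /commg /conjg ?gnorm. Qed.

Lemma commgV x z : [~ z, x^-1] = ([~ z, x]^-1) ^ x^-1.
Proof. by rewrite /commg /conjg ?gnorm. Qed.

Lemma commJg x y z : [~ x ^ z, y] = [~ x, y ^ z^-1] ^ z.
Proof. by rewrite /commg /conjg ?gnorm. Qed.

Lemma is_subgroup_gen S : is_subgroup (gen_subgroup S).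
Proof.
split=> [T [[]]//|x y Sx Sy T TP|x Sx T TP].
  by have [[_ TM _] _] := TP; apply: TM; [apply: Sx|apply: Sy].
by have [[_ _ TV] _] := TP; apply: TV; apply: Sx.
Qed.

Lemma sub_gen_subgroup S : S `<=` gen_subgroup S.
Proof. exact: sub_smallest. Qed.

Lemma gen_subgroup_sub S T : is_subgroup T -> S `<=` T -> gen_subgroup S `<=` T.
Proof. exact: smallest_sub. Qed.

Lemma subgroup1 T : is_subgroup T -> T 1.
Proof. by case. Qed.

Lemma subgroupM T x y : is_subgroup T -> T x -> T y -> T (x * y).
Proof. by case=> _ + _; apply. Qed.

Lemma subgroupV T x : is_subgroup T -> T x -> T x^-1.
Proof. by case=> _ _; apply. Qed.

Lemma subgroupX T x k : is_subgroup T -> T x -> T (x ^+ k).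
Proof.
move=> [T1 TM _] Tx; elim: k => [|k IHk]; first by rewrite expg0.
by rewrite expgS; apply: TM.
Qed.

Lemma subgroupJ T x y : is_subgroup T -> T x -> T y -> T (x ^ y).
Proof.
by move=> sT Tx Ty; apply: subgroupM => //; [apply: subgroupV|apply: subgroupM].
Qed.

Lemma subgroupR T x y : is_subgroup T -> T x -> T y -> T [~ x, y].
Proof.
by move=> sT Tx Ty; apply: subgroupM (subgroupV _ _) (subgroupJ _ _ _).
Qed.

Lemma subgroup_prod T w :
  is_subgroup T -> (forall x, x \in w -> T x) -> T (\prod_(x <- w) x).
Proof.
move=> [T1 TM _] wT; rewrite big_seq; elim/big_ind: _ => // x xw; exact: wT.
Qed.

Lemma gen_words S x : (forall y, S y -> S y^-1) -> gen_subgroup S x ->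
  exists2 w, forall y, y \in w -> S y & x = \prod_(y <- w) y.
Proof.
move=> SV; move: x; apply: gen_subgroup_sub => [|x Sx]; last first.
  by exists [:: x]; rewrite ?big_seq1 // => y /[!inE]/eqP->.
split=> [|x y [w wS ->] [w' wS' ->]|x [w wS ->]].
- by exists [::] => //; rewrite big_nil.
- exists (w ++ w'); last by rewrite big_cat.
  by move=> z; rewrite mem_cat => /orP[/wS|/wS'].
- exists (rev (map (fun z => z^-1) w)).
    by move=> z; rewrite mem_rev => /mapP[u /wS Su ->]; apply: SV.
  by rewrite -map_rev big_map prodgV revK.
Qed.

Lemma gen_normal S : (forall x t, S x -> gen_subgroup S (x ^ t)) ->
  forall x t, gen_subgroup S x -> gen_subgroup S (x ^ t).
Proof.
have [S1 SM SV] := is_subgroup_gen S.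
move=> SJ x t Sx; move: x Sx t.
apply: (@gen_subgroup_sub S [set x | forall t, gen_subgroup S (x ^ t)]); last first.
  by move=> x Sx t; apply: SJ.
split=> [t|x y Sx Sy t|x Sx t] /=; first by rewrite conj1g.
  by rewrite conjMg; apply: SM.
by rewrite conjVg; apply: SV.
Qed.

Lemma conj_class_refl x : conj_class x x.
Proof. by exists 1; rewrite ?conjg1. Qed.

Lemma conj_class_trans x y z :
  conj_class x y -> conj_class y z -> conj_class x z.
Proof. by move=> [g _ <-] [h _ <-]; exists (g * h); rewrite ?conjgM. Qed.

(** * Schur's theorem with an explicit bound *)

(* Letters equal to [c] are moved to the front by conjugating the letters they
   cross. *)
Lemma collect_letter S c w : S c ->
  (forall x y, S x -> S y -> S (x ^ y)) -> (forall x, x \in w -> S x) ->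
  exists w', [/\ forall x, x \in w' -> S x,
    (size w' + count_mem c w)%N = size w &
    \prod_(x <- w) x = c ^+ count_mem c w * \prod_(x <- w') x].
Proof.
move=> Sc SJ; elim: w => [|x w IHw] wS.
  by exists [::]; split; rewrite ?big_nil ?mulg1.
have [|w' [w'S sw' ew']] := IHw; first by move=> y yw; apply: wS; rewrite inE yw orbT.
have Sx : S x by apply: wS; rewrite mem_head.
rewrite big_cons ew' /=; have [->|_] := eqVneq x c.
  by exists w'; split=> //; [rewrite addnCA sw'|rewrite expgS mulgA].
exists (x ^ (c ^+ count_mem c w) :: w'); split.
- move=> y /[!inE]/predU1P[->|/w'S//].
  elim: (count_mem c w) => [|k IHk]; first by rewrite expg0 conjg1.
  by rewrite expgSr conjgM; apply: SJ.
- by rewrite /= add0n addSn sw'.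
- by rewrite big_cons add0n mulgA (conjgC x) -mulgA.
Qed.

(* Once [c ^+ k] is central, [k.+1] copies of a commutator [c] can be traded for
   [k] commutators, which bounds the length of a product of commutators. *)
Lemma comm_exp k x y : (0 < k)%N -> commute y ([~ x, y] ^+ k) ->
  [~ x, y] ^+ k.+1 = [~ x, y ^+ 2] * ([~ x, y] ^ y) ^+ k.-1.
Proof.
case: k => // k _ cyk.
have -> : [~ x, y] ^+ k.+2 = x^-1 * y^-1 * x * [~ x, y] ^+ k.+1 * y.
  rewrite -[RHS]mulgA -cyk expgS mulgA; congr (_ * _).
  by rewrite /commg /conjg ?gnorm.
rewrite expgS -conjXg /commg /conjg !expg2 ?gnorm.
by rewrite ?mulgA.
Qed.

Definition schur_bound q := ((q * q) ^ (q * q * q`!))%N.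

(** Since [r] represents [T] modulo its centre, commutators take at most q^2 values and q!-th powers
    are central. A product of more than q^2 q! commutators repeats a letter more than q! times;
    collecting the copies and applying [comm_exp] shortens it. The bound counts the remaining
    words. *)
Lemma schur T (r : seq G) q : is_subgroup T -> (size r <= q)%N ->
  (forall t, T t -> exists2 u, u \in r &
     T u /\ forall x, T x -> commute x (t * u^-1)) ->
  covered (comm_subgroup T T) (schur_bound q).
Proof.
move=> sT rq /= rT.
have /choice[c cP] t : exists u, T t ->
    [/\ u \in r, T u & forall x, T x -> commute x (t * u^-1)].
  have [Tt|nTt] := pselect (T t); last by exists 1.
  by have [u ur [Tu cu]] := rT t Tt; exists u.
pose S : set G := [set [~ a, b] | a in T & b in T].
have ST x : S x -> T x by move=> [a Ta [b Tb <-]]; apply: subgroupR.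
have SJ x t : S x -> T t -> S (x ^ t).
  move=> [a Ta [b Tb <-]] Tt; rewrite conjRg.
  by exists (a ^ t); [apply: subgroupJ|exists (b ^ t) => //; apply: subgroupJ].
have S1 : S 1.
  by exists 1; [apply: subgroup1|exists 1; rewrite ?commgg //; apply: subgroup1].
have SV x : S x -> S x^-1.
  by move=> [a Ta [b Tb <-]]; exists b => //; exists a => //; rewrite invgR.
have cover_S : covered S (q * q)%N.
  have cr : covered (fun u => u \in r) q by exists r.
  apply: covered_sub (covered_image2 (fun a b => [~ a, b]) cr cr).
  move=> _ [a Ta [b Tb <-]]; have [ar Tca ca] := cP a Ta; have [br Tcb cb] := cP b Tb.
  exists (c a) => //; exists (c b) => //.
  have comm1 x y z : commute y z -> [~ z * x, y] = [~ x, y].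
    by move=> /commute_sym/commgP/eqP zy; rewrite commMg zy conj1g mul1g.
  have comm2 x y z : commute y z -> [~ y, z * x] = [~ y, x].
    by move=> /commgP/eqP zy; rewrite commgM zy conj1g mulg1.
  rewrite -[a in LHS](mulgVK (c a)) comm1; last exact: ca.
  by rewrite -[b in LHS](mulgVK (c b)) comm2 //; apply: cb.
have centralX x t : T x -> T t -> commute t (x ^+ q`!).
  (* Two of x^0, ..., x^q share a coset of the centre, so some x^(j - i) with 0 < j - i <= q is
     central. *)
  move=> Tx Tt; pose s := [seq c (x ^+ i) | i <- iota 0 q.+1].
  have TX i : T (x ^+ i) by apply: subgroupX.
  have : ~~ uniq s.
    apply/negP => /uniq_leq_size sub; have /sub : {subset s <= r}.
      by move=> _ /mapP[i _ ->]; have [] := cP _ (TX i).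
    by rewrite size_map size_iota leqNgt ltnS rq.
  move=> /(uniqPn 1)[i [j []]]; rewrite size_map size_iota => lt_ij lt_j.
  have lt_i := ltn_trans lt_ij lt_j.
  rewrite !(nth_map 0%N) ?size_iota // !nth_iota // !add0n => eq_c.
  have [_ _ /(_ t Tt) ci] := cP _ (TX i); have [_ _ /(_ t Tt) cj] := cP _ (TX j).
  have ct : commute t (x ^+ (j - i)).
    have -> : x ^+ (j - i) = (x ^+ j * (c (x ^+ j))^-1) * (x ^+ i * (c (x ^+ i))^-1)^-1.
      by rewrite eq_c invgM invgK mulgA mulgVK expgnFr // ltnW.
    by apply: commuteM => //; apply: commuteV.
  have /dvdnP[k ->] : (j - i %| q`!)%N.
    by apply: dvdn_fact; rewrite subn_gt0 lt_ij /= leq_subLR (leq_trans _ (leq_addl _ _)).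
  by rewrite mulnC expgnA; apply: commuteX.
have powS x : S x -> exists w,
    [/\ forall y, y \in w -> S y, size w = q`! & x ^+ q`!.+1 = \prod_(y <- w) y].
  move=> [a Ta [b Tb <-]]; exists ([~ a, b ^+ 2] :: nseq q`!.-1 ([~ a, b] ^ b)).
  have Sab : S [~ a, b] by exists a => //; exists b.
  split; last 1 first.
  - rewrite big_cons big_nseq iter_mulg_1 comm_exp ?fact_gt0 //.
    by apply: centralX => //; apply: ST.
  - move=> y /[!inE]/predU1P[->|/nseqP[-> _]]; last exact: SJ.
    by exists a => //; exists (b ^+ 2) => //; apply: subgroupX.
  - by rewrite /= size_nseq prednK // fact_gt0.
have [s sq sS] := cover_S.
have short w : (forall y, y \in w -> S y) -> exists w',
    [/\ forall y, y \in w' -> S y, (size w' <= q * q * q`!)%N &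
      \prod_(y <- w) y = \prod_(y <- w') y].
  have [k] := ubnP (size w); elim: k w => // k IHk w le_k wS.
  have [le_w|lt_w] := leqP (size w) (q * q * q`!)%N; first by exists w.
  have [||c' c's lt_c] := @count_large _ s w q`!.
  - by move=> y /wS/sS.
  - by apply: leq_ltn_trans lt_w; rewrite leq_mul2r sq orbT.
  have c'w : c' \in w by rewrite -has_pred1 has_count (leq_ltn_trans _ lt_c).
  have Sc' := wS _ c'w.
  have SJ' y z : S y -> S z -> S (y ^ z) by move=> Sy Sz; apply: SJ (ST _ Sz).
  have [v [vS szv ->]] := collect_letter Sc' SJ' wS.
  have [u [uS szu eu]] := powS _ Sc'.
  (* The q! letters of [u] replace q! + 1 copies of [c'], so [v'] is one letter shorter than [w]. *)
  pose v' := u ++ nseq (count_mem c' w - q`!.+1) c' ++ v.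
  have [||w' [w'S lw' ew']] := IHk v'.
  - rewrite !size_cat size_nseq szu -ltnS; apply: leq_trans le_k.
    by rewrite -szv; lia.
  - move=> y; rewrite !mem_cat => /or3P[/uS|/nseqP[-> _]|/vS] //.
  exists w'; split=> //; rewrite -ew' !big_cat /= big_nseq iter_mulg_1 -eu mulgA.
  by rewrite -expgnDr subnKC.
apply: (@covered_sub _ _ (fun x => exists2 w,
    w \in words s (q * q * q`!)%N & x = \prod_(y <- w) y)); last first.
  apply: covered_image; exists (words s (q * q * q`!)%N) => //.
  by rewrite size_words; apply: leq_exp2rW.
move=> x /(gen_words SV)[w wS ->]; have [w' [w'S lw' ->]] := short w wS.
(* [words] lists words of one exact length; the padding letter 1 is itself a commutator. *)
pose w1 := w' ++ nseq (q * q * q`! - size w') 1.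
have <- : size w1 = (q * q * q`!)%N by rewrite size_cat size_nseq subnKC.
exists w1; last by rewrite big_cat /= big_nseq iter_mulg_1 expg1n mulg1.
apply: mem_words => y; rewrite mem_cat => /orP[/w'S/sS//|/nseqP[-> _]].
exact: sS.
Qed.

End Groups.

(** * Bounded normal subgroups and centralizers modulo them *)

Section FC.
Variables (G : groupType) (H : set G) (n : nat).
Implicit Types (x y z t g h a b u v : G) (S N B : set G) (w L : seq G).

Definition fc_elt x := H x /\ covered (conj_class x) n.

Hypothesis sgH : is_subgroup H.
Hypothesis normH : forall x t, H x -> H (x ^ t).
Hypothesis genH : forall h, H h ->
  exists2 w : seq G, forall x, x \in w -> fc_elt x & h = \prod_(x <- w) x.

Definition fin_normal m N :=
  [/\ is_subgroup N, forall x t, N x -> N (x ^ t) & covered N m].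

(* For normal [N]: the preimage of the centralizer of [HN / N] in [G / N]. *)
Definition cent_mod N : set G := [set y | forall h, H h -> N [~ y, h]].

Definition good m y := exists2 N, fin_normal m N & cent_mod N y.

(** The centralizer of the normal closure of [L]. *)
Definition ncent L : set G :=
  [set v | forall x t, x \in L -> commute v (x ^ t)].

Lemma fin_normal1 : fin_normal 1 [set 1].
Proof.
split; last by exists [:: 1] => // x ->; rewrite mem_head.
  by split=> [//|x y -> ->|x ->] /=; rewrite ?mulg1 ?invg1.
by move=> x t -> /=; rewrite conj1g.
Qed.

Lemma fin_normalM m m' N N' : fin_normal m N -> fin_normal m' N' ->
  [/\ fin_normal (m * m')%N (set_mul N N'), N `<=` set_mul N N' &
      N' `<=` set_mul N N'].
Proof.
move=> [sN nN cN] [sN' nN' cN']; split; first split.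
- split=> [|_ _ [x Nx [y N'y <-]] [z Nz [t N't <-]]|_ [x Nx [y N'y <-]]].
  + by exists 1; [apply: subgroup1|exists 1; rewrite ?mulg1 //; apply: subgroup1].
  + exists (x * z ^ y^-1); first by apply: subgroupM => //; apply: nN.
    exists (y * t); first exact: subgroupM.
    by rewrite /conjg ?gnorm.
  + exists (x^-1 ^ y); first by apply: nN; apply: subgroupV.
    by exists (y^-1); [apply: subgroupV|rewrite /conjg ?gnorm].
- move=> _ t [x Nx [y N'y <-]]; exists (x ^ t); first exact: nN.
  by exists (y ^ t); [apply: nN'|rewrite conjMg].
- apply: covered_sub (covered_image2 (fun x y => x * y) cN cN').
  by move=> _ [x Nx [y N'y <-]]; exists x => //; exists y.
- by move=> x Nx; exists x => //; exists 1; rewrite ?mulg1 //; apply: subgroup1.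
- by move=> x Nx; exists 1; [apply: subgroup1|exists x; rewrite ?mul1g].
Qed.

Lemma fin_normal_le m m' N : (m <= m')%N -> fin_normal m N -> fin_normal m' N.
Proof. by move=> le_mm' [sN nN cN]; split=> //; apply: covered_le cN. Qed.

Lemma cent_mod_sub N N' : N `<=` N' -> cent_mod N `<=` cent_mod N'.
Proof. by move=> sNN' y cy h /cy/sNN'. Qed.

Lemma is_subgroup_cent_mod m N : fin_normal m N -> is_subgroup (cent_mod N).
Proof.
move=> [sN nN _]; split=> [h _|x y cx cy h Hh|x cx h Hh].
- by rewrite comm1g; apply: subgroup1.
- by rewrite commMg; apply: subgroupM => //; [apply: nN; apply: cx|apply: cy].
- by rewrite commVg; apply: nN; apply: subgroupV => //; apply: cx.
Qed.

Lemma cent_modJ m N x t :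
  fin_normal m N -> cent_mod N x -> cent_mod N (x ^ t).
Proof. by move=> [_ nN _] cx h Hh; rewrite commJg; apply: nN; apply: cx; apply: normH. Qed.

Lemma goodM m m' x y : good m x -> good m' y -> good (m * m')%N (x * y).
Proof.
move=> [N fN cx] [N' fN' cy]; have [fNN' sN sN'] := fin_normalM fN fN'.
exists (set_mul N N') => //; apply: subgroupM (is_subgroup_cent_mod fNN') _ _.
  exact: cent_mod_sub cx.
exact: cent_mod_sub cy.
Qed.

Lemma goodJ m x t : good m x -> good m (x ^ t).
Proof. by move=> [N fN cx]; exists N => //; apply: cent_modJ fN cx. Qed.

Lemma ncent_sub L L' : {subset L <= L'} -> ncent L' `<=` ncent L.
Proof. by move=> sLL' v cv x t /sLL'; apply: cv. Qed.

Lemma is_subgroup_ncent L : is_subgroup (ncent L).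
Proof.
split=> [x t _|u v cu cv x t Lx|u cu x t Lx].
- by apply: commute_sym; apply: commute1.
- by apply: commute_sym; apply: commuteM; apply: commute_sym; [apply: cu|apply: cv].
- by apply: commute_sym; apply: commuteV; apply: commute_sym; apply: cu.
Qed.

Lemma ncentJ L u t : ncent L u -> ncent L (u ^ t).
Proof.
move=> cu x t' Lx; have /commgP/eqP e := cu x (t' * t^-1) Lx.
by apply/commgP/eqP; rewrite commJg -conjgM e conj1g.
Qed.

(** Makes finitely many choices uniform by concatenating the lists and multiplying the normal
    subgroups. It is used with k = 0 to merge only subgroups, and with m = 1 to merge only lists. *)
Lemma collect (T : eqType) (R : T -> seq G -> set G -> Prop) k m (s : seq T) :
  (forall i L L' N N', {subset L <= L'} -> N `<=` N' -> R i L N -> R i L' N') ->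
  (forall i, i \in s -> exists L N, [/\ (size L <= k)%N,
     forall x, x \in L -> fc_elt x, fin_normal m N & R i L N]) ->
  exists L N, [/\ (size L <= size s * k)%N, forall x, x \in L -> fc_elt x,
     fin_normal (m ^ size s)%N N & forall i, i \in s -> R i L N].
Proof.
move=> Rmono; elim: s => [|i s IHs] sR.
  by exists [::], [set 1]; split=> //; apply: fin_normal1.
have [|L [N [sL fL fN RN]]] := IHs; first by move=> j js; apply: sR; rewrite inE js orbT.
have [L' [N' [sL' fL' fN' RN']]] := sR i (mem_head _ _).
have [fNN' sN' sN] := fin_normalM fN' fN.
exists (L' ++ L), (set_mul N' N); split.
- by rewrite size_cat mulSn leq_add.
- by move=> x; rewrite mem_cat => /orP[/fL'|/fL].
- by rewrite expnS.
- move=> j /[!inE]/predU1P[->|js].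
    by apply: Rmono RN' => // x xL; rewrite mem_cat xL.
  by apply: Rmono (RN _ js) => // x xL; rewrite mem_cat xL orbT.
Qed.

(** * Bounded index of centralizers *)

(** Counts self-maps of a set of at most nk conjugates; the successor keeps the base positive, which
    makes the power monotone in the exponent. *)
Definition index_bound k := ((n * k).+1 ^ (n * k))%N.

(** Conjugation permutes the set [C] of conjugates of elements of [L] with kernel [ncent L], so one
    representative per action suffices. *)
Lemma ncent_reps L k B : (forall x, x \in L -> fc_elt x) -> (size L <= k)%N ->
  exists r : seq G, [/\ (size r <= index_bound k)%N, forall x, x \in r -> B x &
    forall x, B x -> exists2 y, y \in r & ncent L (x * y^-1)].
Proof.
move=> fL sL.
have [M sM LM] : covered (fun y => exists2 x, x \in L & conj_class x y) (n * k)%N.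
  apply: (@covered_le _ _ (n * size L)%N); first by rewrite leq_mul2l sL orbT.
  elim: L fL {sL} => [|x L IHL] fL; first by exists [::] => // y [].
  have [_ [s sn sx]] := fL x (mem_head _ _).
  have [|M sM LM] := IHL; first by move=> z zL; apply: fL; rewrite inE zL orbT.
  exists (s ++ M); first by rewrite size_cat mulnS leq_add.
  move=> y [z /[!inE]/predU1P[->|zL] zy]; rewrite mem_cat; first by rewrite sx.
  by rewrite [y \in M]LM ?orbT //; exists z.
(* [M] may contain other elements, while the action needs a set stable under conjugation. *)
pose C := [seq y <- M | `[< exists2 x, x \in L & conj_class x y >]].
have CP y : (y \in C) <-> exists2 x, x \in L & conj_class x y.
  rewrite mem_filter; split=> [/andP[/asboolP] //|yL].
  by rewrite LM // andbT; apply/asboolP.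
pose c g := [seq y ^ g | y <- C].
have cC g : B g -> c g \in words C (size C).
  move=> _; rewrite -(size_map (fun y => y ^ g) C); apply: mem_words.
  move=> _ /mapP[y /CP[x xL xy] ->]; apply/CP; exists x => //.
  by apply: conj_class_trans xy _; exists g.
have [r [rC rB rc]] := covered_reps cC.
exists r; split=> //.
  apply: leq_trans rC _; rewrite size_words.
  have sC : (size C <= n * k)%N.
    by apply: leq_trans sM; rewrite size_filter count_size.
  by apply: leq_trans (leq_exp2rW _ (leqW sC)) _; rewrite leq_pexp2l.
move=> x Bx; have [y yr /eq_in_map exy] := rc x Bx; exists y => // z t zL.
have ztC : z ^ t \in C by apply/CP; exists z => //; exists t.
by apply/commute_sym/commgP/conjg_fixP; rewrite conjgM exy // conjgK.
Qed.

(** * Elements with bounded classes are good *)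

(** If two prefixes of a word conjugate [a] to the same element, the segment between them can be cut
    out. So m letters suffice for each of the at most m conjugates, and [L] gathers all these
    letters. *)
Lemma class_words a m :
  covered (fun y => exists2 h, H h & y = a ^ h) m ->
  exists L, [/\ (size L <= m * m)%N, forall x, x \in L -> fc_elt x &
    forall h, H h -> exists2 w, {subset w <= L} & a ^ h = a ^ (\prod_(x <- w) x)].
Proof.
move=> [s sm sa].
have short w : (forall x, x \in w -> fc_elt x) -> exists w',
    [/\ forall x, x \in w' -> fc_elt x, (size w' <= m)%N &
      a ^ (\prod_(x <- w) x) = a ^ (\prod_(x <- w') x)].
  have [k] := ubnP (size w); elim: k w => // k IHk w le_k fw.
  have [le_w|lt_w] := leqP (size w) m; first by exists w.
  pose p := [seq a ^ (\prod_(x <- take i w) x) | i <- iota 0 (size w)].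
  have : ~~ uniq p.
    apply/negP => /uniq_leq_size sub; have /sub : {subset p <= s}.
      move=> _ /mapP[i _ ->]; apply: sa; eexists; last by [].
      by apply: subgroup_prod => // x /mem_take/fw[].
    by rewrite size_map size_iota leqNgt (leq_ltn_trans sm).
  move=> /(uniqPn 1)[i [j []]]; rewrite size_map size_iota => lt_ij lt_j.
  have lt_i := ltn_trans lt_ij lt_j.
  rewrite !(nth_map 0%N) ?size_iota // !nth_iota // !add0n => eq_ij.
  have [||w' [fw' sw' ew']] := IHk (take i w ++ drop j w).
  - by rewrite size_cat size_take lt_i size_drop; lia.
  - by move=> x; rewrite mem_cat => /orP[/mem_take|/mem_drop] /fw.
  exists w'; split=> //; rewrite -ew'.
  by rewrite -[w in LHS](cat_take_drop j) !big_cat !conjgM eq_ij.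
pose R y L N := (exists2 h, H h & y = a ^ h) ->
  exists2 w, {subset w <= L} & y = a ^ (\prod_(x <- w) x).
have [|y ys|L [N [sL fL _ RL]]] := @collect _ R m 1 s.
- by move=> y L L' N N' sLL' _ Ry /Ry[w wL ->]; exists w => // x /wL/sLL'.
- have [[h Hh ->]|ny] := pselect (exists2 h, H h & y = a ^ h); last first.
    by exists [::], [set 1]; split=> //; apply: fin_normal1.
  have [w fw ->] := genH Hh; have [w' [fw' sw' ->]] := short w fw.
  exists w', [set 1]; split=> //; first exact: fin_normal1.
  by move=> _; exists w'.
exists L; split=> //; first by apply: leq_trans sL _; rewrite leq_mul2r sm orbT.
by move=> h Hh; apply: RL; [apply: sa; exists h|exists h].
Qed.

(** The n^2 letters given by [class_words], and one more for the element itself. *)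
Definition good_bound := schur_bound (index_bound (n * n).+1).

(** Let [T] be the normal closure of [x] and the letters of [class_words]. Its centre contains its
    intersection with [ncent L'], so has bounded index, and Schur's theorem bounds the derived
    subgroup of [T]. That subgroup contains each [x, h], which equals [x, w] for some w in [T]. *)
Lemma fc_good x : fc_elt x -> good good_bound x.
Proof.
move=> fx; have [Hx cx] := fx.
have [|L [sL fL xL]] := @class_words x n.
  by apply: covered_sub cx => y [h _ ->]; exists h.
pose L' := x :: L; pose F : set G := [set y | exists2 z, z \in L' & conj_class z y].
pose T := gen_subgroup F; have sT : is_subgroup T by apply: is_subgroup_gen.
have FT : F `<=` T by apply: sub_gen_subgroup.
have nT y t : T y -> T (y ^ t).
  apply: gen_normal => z u [z' z'L zz']; apply: FT; exists z' => //.
  by apply: conj_class_trans zz' _; exists u.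
have fL' y : y \in L' -> fc_elt y by rewrite inE => /predU1P[->|/fL].
have cT v y : ncent L' v -> T y -> commute y v.
  move=> cv; move: y; apply: gen_subgroup_sub.
    split=> [|y z cy cz|y cy] /=.
    - by apply: commute_sym; apply: commute1.
    - by apply: commute_sym; apply: commuteM; apply: commute_sym.
    - by apply: commute_sym; apply: commuteV; apply: commute_sym.
  by move=> y [z zL [t _ <-]]; apply/commute_sym/cv.
have cover_T' : covered (comm_subgroup T T) good_bound.
  have [s [ss sT' rs]] := @ncent_reps L' (n * n).+1 T fL' sL.
  apply: (schur (r := s)) => // t Tt; have [u us cu] := rs t Tt.
  by exists u => //; split=> [|y]; [apply: sT'|apply: cT].
exists (comm_subgroup T T).
  split=> //; first exact: is_subgroup_gen.
  apply: gen_normal => _ t [y Ty [z Tz <-]]; rewrite conjRg; apply: sub_gen_subgroup.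
  by exists (y ^ t); [apply: nT|exists (z ^ t) => //; apply: nT].
move=> h /xL[w wL exw]; rewrite commgEl exw -commgEl; apply: sub_gen_subgroup.
exists x; first by apply: FT; exists x; [rewrite mem_head|apply: conj_class_refl].
exists (\prod_(y <- w) y) => //; apply: subgroup_prod => // y yw.
by apply: FT; exists y; [rewrite inE wL ?orbT|apply: conj_class_refl].
Qed.

(** * Maximal classes of good elements *)

Lemma good_class m a :
  good m a -> covered (fun y => exists2 h, H h & y = a ^ h) m.
Proof.
move=> [N [_ _ cN] ca]; apply: covered_sub (covered_image (fun x => a * x) cN).
by move=> _ [h Hh ->]; exists [~ a, h]; [apply: ca|rewrite commgEl mulVKg].
Qed.

Lemma cent_modJV m N x t :
  fin_normal m N -> cent_mod N (x ^ t) -> cent_mod N x.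
Proof. by move=> fN /(cent_modJ t^-1 fN); rewrite conjgK. Qed.

Lemma cent_modMr m N x y : fin_normal m N -> cent_mod N y ->
  cent_mod N (x * y) -> cent_mod N x.
Proof.
move=> fN cy cxy; have sC := is_subgroup_cent_mod fN.
by rewrite -(mulgK y x); apply: (subgroupM sC) => //; apply: (subgroupV sC).
Qed.

(* If [v * a] has an [H]-class no larger than that of [a], and [v] commutes with
   elements [b_i] of [H] such that the [a ^ b_i] exhaust the class of [a], then
   the class of [v * a] consists of the [v * a ^ b_i]; thus [v^-1 * v ^ h] is a
   quotient of two conjugates of [a] for every [h] in [H]. *)
Lemma max_class S m : (exists a, S a) -> (forall a, S a -> good m a) ->
  exists2 a, S a & exists L N,
    [/\ (size L <= m * m)%N, forall x, x \in L -> fc_elt x, fin_normal m N &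
        forall v t, ncent L v -> S (v * a ^ t) -> cent_mod N v].
Proof.
move=> [a0 Sa0] goodS.
pose cl a s := uniq s /\ forall y, y \in s -> exists2 h, H h & y = a ^ h.
have cl_le a s : S a -> cl a s -> (size s <= m)%N.
  move=> /goodS/good_class[s' sm as'] [us sa]; apply: leq_trans sm.
  by apply: uniq_leq_size => // y /sa/as'.
pose P k := `[< exists a s, [/\ S a, cl a s & size s = k] >].
have exP : exists k, P k.
  by exists 0%N; apply/asboolP; exists a0, [::].
have bP k : P k -> (k <= m)%N.
  by move=> /asboolP[a [s [Sa /(cl_le _ _ Sa) + <-]]].
have [_ /asboolP[a [s [Sa [us sa] <-]]] max_s] := ex_maxnP exP bP.
exists a => //; have [L [sL fL aL]] := class_words (good_class (goodS a Sa)).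
have [N fN ca] := goodS a Sa; exists L, N; split=> // v t cv Sva.
(* Both [cent_mod N] and [ncent L] are normal, so [t] can be moved from [a] to [v]. *)
rewrite -(conjgKV t v); apply: (cent_modJ _ fN); set u := v ^ t^-1.
have cu : ncent L u by apply: ncentJ.
have uat : (u * a) ^ t = v * a ^ t by rewrite conjMg conjgKV.
(* The [u * y] with [y] in [s] are [size s] distinct conjugates of [u * a] under [H]; one more,
   after conjugation by [t], would give [v * a ^ t] too large a class. *)
have clu h : H h -> (u * a) ^ h \in [seq u * y | y <- s].
  move=> Hh; apply: contrapT => /negP nin.
  suff : (size s < size s)%N by rewrite ltnn.
  apply: max_s; apply/asboolP; exists (v * a ^ t).
  exists [seq y ^ t | y <- (u * a) ^ h :: [seq u * y | y <- s]].
  split=> //; last by rewrite !size_map /= size_map.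
  split.
    rewrite map_inj_uniq; last exact: conjg_inj.
    by rewrite /= nin map_inj_uniq //; apply: mulgI.
  rewrite -uat => _ /mapP[y /predU1P[->|/mapP[z /sa[k Hk ->] ->]] ->].
    by exists (h ^ t); [apply: normH|rewrite conjJg].
  have [w wL ->] := aL k Hk; have Hw : H (\prod_(x <- w) x).
    by apply: subgroup_prod => // x /wL/fL[].
  exists ((\prod_(x <- w) x) ^ t); first exact: normH.
  rewrite -conjJg; congr (_ ^ _); rewrite conjMg; congr (_ * _).
  apply/esym/conjg_fixP/commgP.
  apply: (@subgroup_prod _ [set x | commute u x]) => [|x /wL xL]; last first.
    by rewrite /= -[x]conjg1; apply: cu.
  split=> [|x1 x2 ux1 ux2|x ux] /=.
  - exact: commute1.
  - exact: commuteM.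
  - exact: commuteV.
move=> h Hh; have [sN nN _] := fN.
have /mapP[y /sa[k Hk ->] e] := clu h Hh.
have -> : [~ u, h] = ([~ a, k] * [~ a, h]^-1) ^ a^-1.
  rewrite commgEl -[u ^ h](mulgK (a ^ h)) -conjMg e.
  by rewrite /commg /conjg ?gnorm.
by apply: nN; apply: (subgroupM sN); [apply: ca|apply: (subgroupV sN); apply: ca].
Qed.

(** * Uniform bounds for families of commutators *)

Lemma ncentR L u x : ncent L u -> ncent L [~ u, x].
Proof.
have sC := is_subgroup_ncent L => cu; rewrite commgEl; apply: (subgroupM sC) => //.
  exact: (subgroupV sC).
exact: ncentJ.
Qed.

Lemma ncentR' L u x : ncent L u -> ncent L [~ x, u].
Proof.
have sC := is_subgroup_ncent L => cu.
by rewrite -invgR; apply: (subgroupV sC) => //; apply: ncentR.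
Qed.

Definition finite_bound k m := (m ^ k * m ^ (index_bound (k * (m * m)) * k))%N.

(** For each e choose [d, e] with the largest class: since [v d, e] = [v, e]^d [d, e], [max_class]
    controls [v, e] for v in some [ncent L]. Coset representatives leave finitely many commutators,
    whose subgroups are multiplied together. *)
Lemma finite_good (E : seq G) k m : (0 < m)%N -> (size E <= k)%N ->
  (forall g e, e \in E -> good m [~ g, e]) ->
  exists2 N, fin_normal (finite_bound k m) N &
    forall g e, e \in E -> cent_mod N [~ g, e].
Proof.
move=> m_gt0 sE goodE.
pose R e L N := forall v, ncent L v -> cent_mod N [~ v, e].
have [|e eE|L [N [sL fL fN RL]]] := @collect _ R (m * m) m E.
- by move=> e L L' N N' /ncent_sub sLL' /cent_mod_sub sNN' Re v /sLL'/Re/sNN'.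
- have [||_ [d _ <-] [L [N [sL fL fN LN]]]] :=
    @max_class [set [~ d, e] | d in [set: G]] m.
  + by exists [~ 1, e]; exists 1.
  + by move=> _ [d _ <-]; apply: goodE.
  exists L, N; split=> // v cv; apply: (@cent_modJV m N _ d fN).
  apply: (LN _ 1); first by apply: ncentJ; apply: ncentR.
  by exists (v * d) => //; rewrite commMg conjg1.
have [|r [sr _ rG]] := @ncent_reps L (k * (m * m)) setT fL.
  by apply: leq_trans sL _; rewrite leq_mul2r sE orbT.
pose R' (p : G * G) L N := cent_mod N [~ p.1, p.2].
have [|_ /allpairsP[[g e] [_ eE ->]]|L' [N' [_ _ fN' RN']]] :=
    @collect _ R' 0 m [seq (g, e) | g <- r, e <- E].
- by move=> p L1 L2 N1 N2 _ /cent_mod_sub sN12 /sN12.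
- by have [N' fN' cge] := goodE g e eE; exists [::], N'.
have [fNN' sN sN'] := fin_normalM fN fN'; exists (set_mul N N').
  apply: fin_normal_le fNN'; rewrite size_allpairs.
  by apply: leq_mul; rewrite leq_pexp2l // leq_mul.
move=> g e eE; have [g' g'r cg] := rG g I.
have sC := is_subgroup_cent_mod fNN'.
rewrite -[g in [~ g, _]](mulgVK g') commMg; apply: (subgroupM sC) => //.
  by apply: (cent_modJ _ fNN'); apply: (cent_mod_sub sN); apply: RL.
by apply: (cent_mod_sub sN'); apply: (RN' (g', e)); apply: allpairs_f.
Qed.

(** The maximum is taken over one pair of cosets of [ncent L0], so that d and e can later replace
    the representatives [g0] and [b0]. *)
Lemma max_pair B L0 m g0 b0 : is_subgroup B -> B b0 ->
  (forall g b, B b -> good m [~ g, b]) ->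
  exists d e L N, [/\ ncent L0 (d * g0^-1), B e & ncent L0 (e * b0^-1)] /\
    [/\ (size L <= m * m)%N, forall x, x \in L -> fc_elt x, fin_normal m N &
    forall u v, ncent L0 u -> ncent L u -> B v -> ncent L0 v -> ncent L v ->
      [/\ cent_mod N [~ u, e], cent_mod N [~ d, v] & cent_mod N [~ u, v]]].
Proof.
move=> sB Bb0 goodB; have sC0 := is_subgroup_ncent L0.
have [||_ [d cd [e [Be ce] <-]] [L [N [sL fL fN LN]]]] := @max_class
  [set [~ g, b] | g in [set g | ncent L0 (g * g0^-1)]
                & b in [set b | B b /\ ncent L0 (b * b0^-1)]] m.
- exists [~ g0, b0]; exists g0; first by rewrite /= mulgV; apply: (subgroup1 sC0).
  by exists b0 => //; split=> //; rewrite /= mulgV; apply: (subgroup1 sC0).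
- by move=> _ [g _ [b [Bb _] <-]]; apply: goodB.
exists d, e, L, N; split=> //; split=> // u v c0u cu Bv c0v cv.
have sC := is_subgroup_ncent L; have sM := is_subgroup_cent_mod fN.
(* [x d, e y] is the displayed element times [d, e]^y, so [max_class] applies with t = y. Taking x =
   1 isolates [d, v], y = 1 isolates [u, e], and the general case then leaves [u, v]. *)
have key x y : ncent L0 x -> ncent L x -> B y -> ncent L0 y -> ncent L y ->
    cent_mod N (([~ x, y] * [~ x, e] ^ y) ^ d * [~ d, y]).
  move=> c0x cx By c0y cy; apply: (LN _ y).
    apply: (subgroupM sC) => //; last exact: ncentR'.
    apply: ncentJ; apply: (subgroupM sC) => //; first exact: ncentR.
    by apply: ncentJ; apply: ncentR.
  exists (x * d); first by rewrite /= -mulgA; apply: (subgroupM sC0).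
  exists (e * y); last by rewrite commMg !commgM !mulgA.
  split; first exact: (subgroupM sB).
  rewrite /= (_ : e * y * b0^-1 = y ^ e^-1 * (e * b0^-1)).
    by apply: (subgroupM sC0) => //; apply: ncentJ.
  by rewrite /conjg ?gnorm.
have c1 : cent_mod N [~ d, v].
  have := key 1 v (subgroup1 sC0) (subgroup1 sC) Bv c0v cv.
  by rewrite !comm1g conj1g mulg1 conj1g mul1g.
have c2 : cent_mod N [~ u, e].
  have := key u 1 c0u cu (subgroup1 sB) (subgroup1 sC0) (subgroup1 sC).
  by rewrite !commg1 mulg1 mul1g conjg1 => /(cent_modJV fN).
split=> //; have /(cent_modMr fN c1)/(cent_modJV fN) := key u v c0u cu Bv c0v cv.
by apply: (cent_modMr fN); apply: (cent_modJ _ fN).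
Qed.

(** In [subgroup_good], the two indices bound the numbers of cosets of [ncent L1] and [ncent L3],
    and the factors of [subgroup_bound] come from [N1], [N2] and [N4]. *)
Definition subgroup_index1 m := index_bound (m * m).
Definition subgroup_index2 m :=
  index_bound (m * m + subgroup_index1 m * subgroup_index1 m * (m * m)).
Definition subgroup_bound m :=
  (m * m ^ (subgroup_index1 m * subgroup_index1 m)
     * m ^ (subgroup_index2 m * subgroup_index2 m))%N.

Lemma subgroup_good B m : (0 < m)%N -> is_subgroup B ->
  (forall g b, B b -> good m [~ g, b]) ->
  exists2 N, fin_normal (subgroup_bound m) N &
    forall g b, B b -> cent_mod N [~ g, b].
Proof.
move=> m_gt0 sB goodB; have B1 := subgroup1 sB.
(* For the empty list [ncent] is the whole group, so this first maximum is unrestricted. *)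
have [d1 [e1 [L1 [N1 [_ [sL1 fL1 fN1 LN1]]]]]] := @max_pair B [::] m 1 1 sB B1 goodB.
have {}LN1 u v : ncent L1 u -> B v -> ncent L1 v -> cent_mod N1 [~ u, v].
  by move=> cu Bv cv; have [] := LN1 u v.
have sC1 := is_subgroup_ncent L1.
have [r [sr _ rG]] := @ncent_reps L1 (m * m) setT fL1 sL1.
have [q [sq qB rB]] := @ncent_reps L1 (m * m) B fL1 sL1.
pose R (p : G * G) L N := exists d e,
  [/\ ncent L1 (d * p.1^-1), B e & ncent L1 (e * p.2^-1)] /\
  forall u v, ncent L1 u -> ncent L u -> B v -> ncent L1 v -> ncent L v ->
    cent_mod N [~ u, e] /\ cent_mod N [~ d, v].
have [|_ /allpairsP[[g b] [_ /qB Bb ->]]|L2 [N2 [sL2 fL2 fN2 RN2]]] :=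
    @collect _ R (m * m) m [seq (g, b) | g <- r, b <- q].
- move=> p L L' N N' /ncent_sub sLL' /cent_mod_sub sNN' [d [e [de LN]]].
  exists d, e; split=> // u v c1u /sLL' cu Bv c1v /sLL' cv.
  by have [/sNN' ? /sNN' ?] := LN u v c1u cu Bv c1v cv.
- have [d [e [L [N [de [sL fL fN LN]]]]]] := @max_pair B L1 m g b sB Bb goodB.
  exists L, N; split=> //; exists d, e; split=> // u v c1u cu Bv c1v cv.
  by have [] := LN u v c1u cu Bv c1v cv.
have [fN3 sN13 sN23] := fin_normalM fN1 fN2; set N3 := set_mul N1 N2 in fN3 sN13 sN23.
have sM3 := is_subgroup_cent_mod fN3.
pose L3 := L1 ++ L2.
have c31 u : ncent L3 u -> ncent L1 u.
  by apply: ncent_sub => x xL; rewrite mem_cat xL.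
have c32 u : ncent L3 u -> ncent L2 u.
  by apply: ncent_sub => x xL; rewrite mem_cat xL orbT.
(* As b and e share a coset of [ncent L1], [u, b] splits into [u, e], controlled by [N2], and a
   conjugate of [u, b e^-1], controlled by [N1]. *)
have c3B u b : ncent L3 u -> B b -> cent_mod N3 [~ u, b].
  move=> cu Bb; have [g0 g0r _] := rG 1 I; have [b0 b0q cb] := rB b Bb.
  have [d [e [[_ Be ce] LN]]] := RN2 (g0, b0) (allpairs_f _ g0r b0q).
  have [cue _] := LN u 1 (c31 u cu) (c32 u cu) B1 (subgroup1 sC1)
    (subgroup1 (is_subgroup_ncent L2)).
  rewrite -[b in [~ _, b]](mulgVK e) commgM; apply: (subgroupM sM3) => //.
    exact: (cent_mod_sub sN23).
  apply: (cent_modJ _ fN3); apply: (cent_mod_sub sN13); apply: LN1; first exact: c31.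
    by apply: subgroupM => //; apply: subgroupV.
  rewrite -(mulgKA b0^-1); apply: (subgroupM sC1) => //; exact: (subgroupV sC1).
have cG3 g v : B v -> ncent L3 v -> cent_mod N3 [~ g, v].
  move=> Bv cv; have [g0 g0r cg] := rG g I; have [b0 b0q _] := rB 1 B1.
  have [d [e [[cd _ _] LN]]] := RN2 (g0, b0) (allpairs_f _ g0r b0q).
  have [_ cdv] := LN 1 v (subgroup1 sC1) (subgroup1 (is_subgroup_ncent L2))
    Bv (c31 v cv) (c32 v cv).
  rewrite -[g in [~ g, _]](mulgVK d) commMg; apply: (subgroupM sM3) => //; last first.
    exact: (cent_mod_sub sN23).
  apply: (cent_modJ _ fN3); apply: (cent_mod_sub sN13); apply: LN1 => //; last exact: c31.
  rewrite -(mulgKA g0^-1); apply: (subgroupM sC1) => //; exact: (subgroupV sC1).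
have sq1 : (size r * size q <= subgroup_index1 m * subgroup_index1 m)%N.
  exact: leq_mul.
have fL3 x : x \in L3 -> fc_elt x by rewrite mem_cat => /orP[/fL1|/fL2].
have sL3 : (size L3 <= m * m + subgroup_index1 m * subgroup_index1 m * (m * m))%N.
  rewrite size_cat leq_add //; apply: leq_trans sL2 _.
  by rewrite size_allpairs leq_mul.
have [r' [sr' _ rG']] := @ncent_reps L3 _ setT fL3 sL3.
have [q' [sq' qB' rB']] := @ncent_reps L3 _ B fL3 sL3.
pose R' (p : G * G) L N := cent_mod N [~ p.1, p.2].
have [|_ /allpairsP[[g b] [_ /qB' Bb ->]]|L4 [N4 [_ _ fN4 RN4]]] :=
    @collect _ R' 0 m [seq (g, b) | g <- r', b <- q'].
- by move=> p L L' N N' _ /cent_mod_sub sNN' /sNN'.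
- by have [N' fN' cgb] := goodB g b Bb; exists [::], N'.
have [fN sN3 sN4] := fin_normalM fN3 fN4; exists (set_mul N3 N4).
  apply: fin_normal_le fN; rewrite !size_allpairs.
  apply: leq_mul; last by rewrite leq_pexp2l // leq_mul.
  by rewrite leq_mul // leq_pexp2l.
move=> g b Bb; have sM := is_subgroup_cent_mod fN.
have [g' g'r cg] := rG' g I; have [b' b'q cb] := rB' b Bb.
rewrite -[g in [~ g, _]](mulgVK g') commMg; apply: (subgroupM sM) => //.
  by apply: (cent_modJ _ fN); apply: (cent_mod_sub sN3); apply: c3B.
rewrite -[b in [~ _, b]](mulgVK b') commgM; apply: (subgroupM sM) => //.
  by apply: (cent_mod_sub sN4); apply: (RN4 (g', b')); apply: allpairs_f.
apply: (cent_modJ _ fN); apply: (cent_mod_sub sN3); apply: cG3 => //.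
by apply: subgroupM => //; apply: subgroupV => //; apply: qB'.
Qed.

End FC.

(** * From approximate subgroups to the final bound *)

(** The cube of [m] arises because each e in [E] is a product of three elements of [A]; the outer
    factor [m] pays for a in [g, x a] = [g, a] [g, x]^a. *)
Definition theorem_bound K n :=
  let m := good_bound n in
  subgroup_bound n (m * finite_bound n K (m * (m * m)))%N.

Lemma approx_subgroup_inv (G : groupType) K (A : set G) a :
  approx_subgroup K A -> A a -> A a^-1.
Proof. by move=> [symA _] Aa; rewrite symA; exists a. Qed.

(** Letters are appended on the right: (x b) a = x (e c) = (x e) c. The empty word is set apart
    because 1 need not lie in [A]. *)
Lemma approx_subgroup_cover (G : groupType) K (A : set G) :
  approx_subgroup K A -> exists E : seq G, [/\ (size E <= K)%N,
    forall e, e \in E -> exists a b c, [/\ A a, A b, A c & e = a * b * c] &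
    forall b, gen_subgroup A b -> b = 1 \/
      exists2 x, gen_subgroup [set` E] x & exists2 a, A a & b = x * a].
Proof.
move=> apA; have AV a := approx_subgroup_inv (a := a) apA.
have [_ [E0 [_ /covered_card_le[s sK sE0] AAE]]] := apA.
pose P e := exists a b c, [/\ A a, A b, A c & e = a * b * c].
(* Any e with b a = e c equals b a c^-1, so the filter keeps every entry that the induction uses. *)
pose E := [seq e <- s | `[< P e >]].
exists E; split=> [|e|b].
- by apply: leq_trans sK; rewrite size_filter count_size.
- by rewrite mem_filter => /andP[/asboolP].
move=> /(gen_words AV)[w wA ->] {b}.
have sgE := is_subgroup_gen [set` E].
elim/last_ind: w wA => [|w a IHw] wA; first by left; rewrite big_nil.
right; rewrite big_rcons; have Aa : A a by apply: wA; rewrite mem_rcons mem_head.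
have [|->|[x Ex [b Ab ->]]] := IHw.
- by move=> c cw; apply: wA; rewrite mem_rcons inE cw orbT.
- by exists 1; [apply: subgroup1|exists a].
have [e E0e [c Ac ec]] : set_mul E0 A (b * a).
  by apply: AAE; exists b => //; exists a.
exists (x * e); last by exists c => //; rewrite -mulgA ec mulgA.
apply: (subgroupM sgE) => //; apply: sub_gen_subgroup => /=.
rewrite mem_filter sE0 // andbT; apply/asboolP; exists b, a, c^-1.
by split=> //; [apply: AV|rewrite -ec mulgK].
Qed.

Theorem theorem1p2 :
  exists f : nat -> nat -> nat,
    forall (K n : nat), (0 < K)%N -> (0 < n)%N ->
    forall (G : groupType) (A : set G),
      approx_subgroup K A ->
      (forall g a : G, A a -> conj_class [~ g, a] #<= `I_n) ->
      let GA : set G := comm_subgroup [set: G] A in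
      finite_set (comm_subgroup GA GA) /\
      comm_subgroup GA GA #<= `I_(f K n).
Proof.
exists theorem_bound => K n _ _ G A apA clA GA; apply: card_le_covered.
have sgH : is_subgroup GA by apply: is_subgroup_gen.
have GAc g a : A a -> GA [~ g, a].
  by move=> Aa; apply: sub_gen_subgroup; exists g => //; exists a.
have normH x t : GA x -> GA (x ^ t).
  apply: gen_normal => _ u [g _ [a Aa <-]].
  rewrite (_ : _ ^ u = [~ g * u, a] * [~ u, a]^-1); last by rewrite commMg mulgK.
  by apply: (subgroupM sgH); [|apply: (subgroupV sgH)]; apply: GAc.
have fcA g a : A a -> fc_elt GA n [~ g, a].
  by move=> Aa; split; [apply: GAc|apply/covered_card_le/clA].
have genH h : GA h -> exists2 w : seq G, forall x, x \in w -> fc_elt GA n x &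
    h = \prod_(x <- w) x.
  move=> GAh; apply: (@gen_words _ (fc_elt GA n)).
    move=> x [GAx cx]; split; first exact: (subgroupV sgH).
    apply: covered_sub (covered_image (fun y => y^-1) cx).
    by move=> _ [g _ <-]; exists (x ^ g); [exists g|rewrite conjVg].
  apply: gen_subgroup_sub GAh; first exact: is_subgroup_gen.
  by move=> _ [g _ [a Aa <-]]; apply: sub_gen_subgroup; apply: fcA.
pose m := good_bound n; have m_gt0 : (0 < m)%N.
  by rewrite !expn_gt0 !muln_gt0 !expn_gt0.
have goodA g a : A a -> good GA m [~ g, a].
  by move=> Aa; apply: (fc_good sgH genH); apply: fcA.
have [E [sE EA genA]] := approx_subgroup_cover apA.
have m3_gt0 : (0 < m * (m * m))%N by rewrite !muln_gt0 m_gt0.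
have [g _ /EA[a [b [c [Aa Ab Ac ->]]]]|N fN cN] :=
    finite_good sgH normH genH m3_gt0 sE.
  rewrite !commgM; apply: goodM => //; first exact: goodA.
  by apply: (goodJ normH); apply: goodM => //; [|apply: (goodJ normH)]; apply: goodA.
have sM := is_subgroup_cent_mod GA fN.
have {}cN x g : gen_subgroup [set` E] x -> cent_mod GA N [~ g, x].
  move=> Ex; move: x Ex g.
  apply: (@gen_subgroup_sub _ _ [set x | forall g, cent_mod GA N [~ g, x]]).
    split=> [g|x y cx cy g|x cx g] /=.
    - by rewrite commg1; apply: (subgroup1 sM).
    - by rewrite commgM; apply: (subgroupM sM) => //; apply: (cent_modJ normH _ fN).
    - by rewrite commgV; apply: (cent_modJ normH _ fN); apply: (subgroupV sM).
  by move=> e Ee g; apply: cN.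
have mN_gt0 : (0 < m * finite_bound n K (m * (m * m)))%N.
  by rewrite !muln_gt0 m_gt0 !expn_gt0 m3_gt0.
have [|g b /genA[->|[x Ex [a Aa ->]]]|N' fN' cN'] :=
    @subgroup_good _ _ _ sgH normH genH (gen_subgroup A) _ mN_gt0.
- exact: is_subgroup_gen.
- rewrite commg1; exists [set 1]; first exact: fin_normal_le (fin_normal1 _).
  by move=> h _; rewrite comm1g.
- rewrite commgM; apply: goodM => //; first exact: goodA.
  by apply: (goodJ normH); exists N => //; apply: cN.
have [sN' _ coverN'] := fN'; apply: covered_sub coverN'.
apply: gen_subgroup_sub => // _ [x GAx [y GAy <-]].
(* [cent_mod GA N'] is a subgroup containing the generators of [G, A], hence all of [G, A]. *)
have: cent_mod GA N' x; last exact.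
apply: gen_subgroup_sub x GAx; first exact: is_subgroup_cent_mod fN'.
by move=> _ [g _ [a Aa <-]]; apply: cN'; apply: sub_gen_subgroup.
Qed.
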